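(* Let $\{x_k\}_{k\ge 0}$ be a sequence of iterates computed by the variable sample spectral gradient algorithm described in the context. Assume that $f_{\mathcal N}:\mathbb R^n\to\mathbb R$ is strongly convex, with unique minimizer $x_*$, and that the gradients $\nabla f_j$, $j=1,\dots,N$, are Lipschitz-continuous on $\mathbb R^n$ with constant $L$. Then: (i) There exists a constant $\rho\in(0,1)$ such that for every index $k\ge 0$ the optimality gap satisfies $$f_{\mathcal N}(x_{k+1})-f_{\mathcal N}(x_* )\le\rho^{k+1}\big(f_{\mathcal N}(x_0)-f_{\mathcal N}(x_* )\big)+\sum_{j=0}^k\rho^j\zeta_{k-j}+\sum_{j=0}^k\rho^j\big(2\nu_{k-j}+C\eta_{k-j}\big),$$ where $C=-\frac{c_1(c_2-1)}{L}$. (ii) If the three sequences $\{\zeta_k\}$, $\{\nu_k\}$, $\{\eta_k\}$ tend to $0$ $R$-linearly as $k\to+\infty$, then $f_{\mathcal N}(x_{k+1})-f_{\mathcal N}(x_* )$ converges to $0$ $R$-linearly.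
   Context: Problem. $f_1,\dots,f_N:\mathbb R^n\to\mathbb R$ are continuously differentiable, $\mathcal N=\{1,\dots,N\}$, and $f_{\mathcal N}(x)=\frac1N\sum_{j=1}^N f_j(x)$. For a nonempty $\mathcal S\subseteq\mathcal N$ put $f_{\mathcal S}(x)=\frac1{|\mathcal S|}\sum_{j\in\mathcal S}f_j(x)$ and $\nabla f_{\mathcal S}(x)=\frac1{|\mathcal S|}\sum_{j\in\mathcal S}\nabla f_j(x)$. $\|\cdot\|$ is the Euclidean norm. Algorithm (variable sample spectral gradient framework). Fixed parameters: $0<\sigma_m<1<\sigma_M<+\infty$, $0<c_1\le c_2<1$, and $\zeta_k>0$ with $\sum_{k\ge0}\zeta_k<+\infty$. Start from $x_0\in\mathbb R^n$, an initial nonempty subsample $\mathcal N_0\subseteq\mathcal N$ of size $N_0$, and an initial coefficient $\sigma_{-1}\in[\sigma_m,\sigma_M]$. At each iteration $k$: 1. (for $k\ge1$) A sample size $N_k\ge N_{k-1}$ and a (randomly generated) subsample $\mathcal N_k\subseteq\mathcal N$ with $|\mathcal N_k|=N_k$ are chosen, according to one of two subsampling rules, fixed for the whole run: nested, i.e. $\mathcal N_{k-1}\subseteq\mathcal N_k$; or non-nested, with the requirement $\mathcal N_{k-1}\cap\mathcal N_k\ne\emptyset$. The statement concerns any resulting realization of the subsamples. 2. (for $k\ge1$) Set $s_{k-1}=x_k-x_{k-1}$ and compute $y_{k-1}$ by one of the following formulas, fixed for the whole run: $y_{k-1}=\nabla f_{\mathcal N_k}(x_k)-\nabla f_{\mathcal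 N_k}(x_{k-1})$ (nested or non-nested case); $y_{k-1}=\nabla f_{\mathcal N_k}(x_k)-\nabla f_{\mathcal N_{k-1}}(x_{k-1})$ (nested case only); $y_{k-1}=\nabla f_{\mathcal I_k}(x_k)-\nabla f_{\mathcal I_k}(x_{k-1})$ with $\mathcal I_k=\mathcal N_k\cap\mathcal N_{k-1}$ (non-nested case only). Set $\sigma_{k-1}=\frac{s_{k-1}^ty_{k-1}}{s_{k-1}^ts_{k-1}}$ if this quantity is defined and lies in $[\sigma_m,\sigma_M]$, and $\sigma_{k-1}=1$ otherwise. 3. Set $d_k=-\sigma_{k-1}^{-1}\nabla f_{\mathcal N_k}(x_k)$. 4. Take a steplength $\alpha_k>0$ satisfying both $$f_{\mathcal N_k}(x_k+\alpha_kd_k)\le f_{\mathcal N_k}(x_k)+c_1\alpha_k\nabla f_{\mathcal N_k}(x_k)^td_k+\zeta_k,$$ $$\nabla f_{\mathcal N_k}(x_k+\alpha_kd_k)^td_k\ge c_2\nabla f_{\mathcal N_k}(x_k)^td_k.$$ 5. Set $x_{k+1}=x_k+\alpha_kd_k$. Approximation errors. For each $k\ge0$, $$\nu_k=\max\{|f_{\mathcal N_k}(x_k)-f_{\mathcal N}(x_k)|,\ |f_{\mathcal N_k}(x_{k+1})-f_{\mathcal N}(x_{k+1})|\},$$ $$\eta_k=\max\Big\{\big|\|\nabla f_{\mathcal N}(x_k)\|^2-\|\nabla f_{\mathcal N_k}(x_k)\|^2\big|,\ \big|\|\nabla f_{\mathcal N}(x_{k+1})\|^2-\|\nabla f_{\mathcal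 N_k}(x_{k+1})\|^2\big|\Big\}.$$ A nonnegative real sequence $\{a_k\}$ converges to $0$ $R$-linearly if there exist $M>0$ and $q\in(0,1)$ with $a_k\le Mq^k$ for all $k$. *)

(* Defs.v *)
From HB Require Import structures.
From mathcomp Require Import all_boot all_order all_algebra.
From mathcomp Require Import all_classical all_reals all_analysis.

Set Implicit Arguments.
Unset Strict Implicit.
Unset Printing Implicit Defensive.

Import Order.TTheory GRing.Theory Num.Theory.
Import numFieldNormedType.Exports.

Local Open Scope ring_scope.

(* The library norm on 'rV[R]_n is the sup norm, so the Euclidean inner product
   and norm are introduced separately. The topology is the same for both norms,
   hence differentiability and continuity are the library notions. *)
Definition dot (R : realType) (n : nat) (u v : 'rV[R]_n) : R :=
  \sum_(i < n) u 0 i * v 0 i.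

Definition enorm (R : realType) (n : nat) (u : 'rV[R]_n) : R :=
  Num.sqrt (dot u u).

Definition grad (R : realType) (n : nat) (f : 'rV[R]_n -> R) (x : 'rV[R]_n) :
    'rV[R]_n :=
  \row_(i < n) 'D_(delta_mx 0 i) f x.

Definition continuously_differentiable (R : realType) (n : nat)
    (f : 'rV[R]_n -> R) : Prop :=
  (forall x, differentiable f x) /\ continuous (grad f).

Definition elipschitz (R : realType) (n : nat) (L : R)
    (F : 'rV[R]_n -> 'rV[R]_n) : Prop :=
  forall x y, enorm (F x - F y) <= L * enorm (x - y).

Definition strongly_convex (R : realType) (n : nat) (f : 'rV[R]_n -> R) : Prop :=
  exists2 mu : R, 0 < mu & forall (x y : 'rV[R]_n) (t : R), 0 <= t <= 1 ->
    f (t *: x + (1 - t) *: y) <=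
      t * f x + (1 - t) * f y - mu / 2 * t * (1 - t) * enorm (x - y) ^+ 2.

Definition unique_minimizer (R : realType) (n : nat) (f : 'rV[R]_n -> R)
    (xs : 'rV[R]_n) : Prop :=
  (forall x, f xs <= f x) /\ (forall y, (forall x, f y <= f x) -> y = xs).

Definition Rlinear_cvg0 (R : realType) (a : nat -> R) : Prop :=
  (forall k, 0 <= a k) /\
  exists M q : R, [/\ 0 < M, 0 < q < 1 & forall k, a k <= M * q ^+ k].

Definition favg (R : realType) (n N : nat) (f : 'I_N -> 'rV[R]_n -> R)
    (A : {set 'I_N}) (x : 'rV[R]_n) : R :=
  #|A|%:R^-1 * \sum_(j in A) f j x.

Definition gavg (R : realType) (n N : nat) (f : 'I_N -> 'rV[R]_n -> R)
    (A : {set 'I_N}) (x : 'rV[R]_n) : 'rV[R]_n :=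
  #|A|%:R^-1 *: \sum_(j in A) grad (f j) x.

Inductive subsampling_rule := Nested | NonNested.

Definition subsampling_ok (N : nat) (rule : subsampling_rule)
    (A B : {set 'I_N}) : Prop :=
  match rule with
  | Nested => A \subset B
  | NonNested => A :&: B != finset.set0
  end.

(* Names refer to the sample(s) used in the difference of gradients. *)
Inductive ydiff_formula := CurrentSample | ConsecutiveSamples | CommonSample.

Definition formula_allowed (rule : subsampling_rule) (form : ydiff_formula) :
    Prop :=
  match form with
  | CurrentSample => True
  | ConsecutiveSamples => rule = Nested
  | CommonSample => rule = NonNested
  end.

Section Run.
Variables (R : realType) (n N : nat) (f : 'I_N -> 'rV[R]_n -> R).

(* Here A, x are the sample and iterate at step k-1, and B, y those at step k. *)
Definition ydiff (form : ydiff_formula) (A B : {set 'I_N}) (x y : 'rV[R]_n) :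
    'rV[R]_n :=
  match form with
  | CurrentSample => gavg f B y - gavg f B x
  | ConsecutiveSamples => gavg f B y - gavg f A x
  | CommonSample => gavg f (B :&: A) y - gavg f (B :&: A) x
  end.

Definition spectral_coef (sigma_m sigma_M : R) (s y : 'rV[R]_n) : R :=
  if (dot s s != 0) && (sigma_m <= dot s y / dot s s <= sigma_M)
  then dot s y / dot s s else 1.

(* Index shift: [sigma k] is the coefficient written sigma_{k-1}, so that
   [sigma 0] is the initial coefficient sigma_{-1}. *)
Definition search_dir (sample : nat -> {set 'I_N}) (x : nat -> 'rV[R]_n)
    (sigma : nat -> R) (k : nat) : 'rV[R]_n :=
  - ((sigma k)^-1 *: gavg f (sample k) (x k)).

Record spectral_run (rule : subsampling_rule) (form : ydiff_formula)
    (sigma_m sigma_M c1 c2 : R) (zeta : nat -> R) (sample : nat -> {set 'I_N})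
    (x : nat -> 'rV[R]_n) (sigma alpha : nat -> R) : Prop := SpectralRun {
  run_formula : formula_allowed rule form ;
  run_sample0 : sample 0%N != finset.set0 ;
  run_size : forall k, (#|sample k| <= #|sample k.+1|)%N ;
  run_sample : forall k, subsampling_ok rule (sample k) (sample k.+1) ;
  run_sigma0 : sigma_m <= sigma 0%N <= sigma_M ;
  run_sigma : forall k, sigma k.+1 =
    spectral_coef sigma_m sigma_M (x k.+1 - x k)
      (ydiff form (sample k) (sample k.+1) (x k) (x k.+1)) ;
  run_alpha : forall k, 0 < alpha k ;
  run_decrease : forall k, let d := search_dir sample x sigma k in
    favg f (sample k) (x k + alpha k *: d) <=
      favg f (sample k) (x k) + c1 * alpha k * dot (gavg f (sample k) (x k)) d + zeta k ;
  run_curvature : forall k, let d := search_dir sample x sigma k in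
    c2 * dot (gavg f (sample k) (x k)) d <=
      dot (gavg f (sample k) (x k + alpha k *: d)) d ;
  run_step : forall k, x k.+1 = x k + alpha k *: search_dir sample x sigma k }.

Definition nu_err (sample : nat -> {set 'I_N}) (x : nat -> 'rV[R]_n) (k : nat) : R :=
  Num.max `|favg f (sample k) (x k) - favg f [set: 'I_N] (x k)|
          `|favg f (sample k) (x k.+1) - favg f [set: 'I_N] (x k.+1)|.

Definition eta_err (sample : nat -> {set 'I_N}) (x : nat -> 'rV[R]_n) (k : nat) : R :=
  Num.max
    `|enorm (gavg f [set: 'I_N] (x k)) ^+ 2 - enorm (gavg f (sample k) (x k)) ^+ 2|
    `|enorm (gavg f [set: 'I_N] (x k.+1)) ^+ 2 -
      enorm (gavg f (sample k) (x k.+1)) ^+ 2|.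

End Run.

(* Main.v *)
(** By the curvature condition and the Lipschitz continuity of the sampled
    gradient, [alpha_k / sigma_{k-1} >= (1 - c2) / L], so that the sampled
    function decreases by at least [C |grad f_{N_k}(x_k)|^2 - zeta_k]. Replacing
    sampled values and gradients by full ones costs [2 nu_k + C eta_k], and
    strong convexity bounds [|grad f_N(x_k)|^2] below by [2 mu] times the
    optimality gap. Hence the gap contracts by [rho = 1 - 2 mu C] up to the
    errors. Moreover [mu <= L], hence [0 < rho < 1], unless the space is
    trivial. *)

Require Import Defs.
From HB Require Import structures.
From mathcomp Require Import all_boot all_order all_algebra.
From mathcomp Require Import all_classical all_reals all_analysis.
From mathcomp Require Import ring lra.

Import Order.TTheory GRing.Theory Num.Theory.
Import numFieldNormedType.Exports.

Local Open Scope ring_scope.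

(** * Euclidean geometry, gradients and strong convexity *)

Section Euclidean.
Context {R : realType} {n : nat}.
Implicit Types u v w : 'rV[R]_n.

Lemma dotC u v : dot u v = dot v u.
Proof. by apply: eq_bigr => i _; rewrite mulrC. Qed.

Lemma dotDl u v w : dot (u + v) w = dot u w + dot v w.
Proof. by rewrite -big_split; apply: eq_bigr => i _; rewrite mxE mulrDl. Qed.

Lemma dotZl (a : R) u v : dot (a *: u) v = a * dot u v.
Proof. by rewrite mulr_sumr; apply: eq_bigr => i _; rewrite mxE mulrA. Qed.

Lemma dotDr u v w : dot u (v + w) = dot u v + dot u w.
Proof. by rewrite !(dotC u) dotDl. Qed.

Lemma dotZr (a : R) u v : dot u (a *: v) = a * dot u v.
Proof. by rewrite !(dotC u) dotZl. Qed.

Lemma dotNl u v : dot (- u) v = - dot u v.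
Proof. by rewrite -scaleN1r dotZl mulN1r. Qed.

Lemma dotNr u v : dot u (- v) = - dot u v.
Proof. by rewrite dotC dotNl dotC. Qed.

Lemma dot0l v : dot 0 v = 0.
Proof. by rewrite -(scale0r v) dotZl mul0r. Qed.

Lemma dot_suml (I : Type) (r : seq I) (P : pred I) (F : I -> 'rV[R]_n) v :
  dot (\sum_(i <- r | P i) F i) v = \sum_(i <- r | P i) dot (F i) v.
Proof.
apply: (big_morph (fun u => dot u v)) => [u w|]; first exact: dotDl.
exact: dot0l.
Qed.

Lemma dot_ge0 u : 0 <= dot u u.
Proof. by apply: sumr_ge0 => i _; rewrite -expr2 sqr_ge0. Qed.

Lemma dot_eq0 u : dot u u = 0 -> u = 0.
Proof.
move=> /eqP; rewrite psumr_eq0 => [/allP u0|i _]; last by rewrite -expr2 sqr_ge0.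
apply/rowP => i; rewrite mxE; apply/eqP.
by have := u0 i (mem_index_enum i); rewrite /= mulf_eq0 orbb.
Qed.

Lemma enorm_ge0 u : 0 <= enorm u.
Proof. exact: sqrtr_ge0. Qed.

Lemma enorm_sqr u : enorm u ^+ 2 = dot u u.
Proof. by rewrite sqr_sqrtr // dot_ge0. Qed.

Lemma enorm_eq0 u : enorm u = 0 -> u = 0.
Proof. by move=> u0; apply: dot_eq0; rewrite -enorm_sqr u0 expr0n. Qed.

(** Cauchy-Schwarz: expand the square of [enorm v *: u - enorm u *: v] and cancel
    [enorm u * enorm v], which is why zero vectors are split off first. *)
Lemma dot_le_enorm u v : dot u v <= enorm u * enorm v.
Proof.
have := enorm_ge0 u; rewrite le_eqVlt => /predU1P[/esym/enorm_eq0 ->|u0].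
  by rewrite dot0l mulr_ge0 ?enorm_ge0.
have := enorm_ge0 v; rewrite le_eqVlt => /predU1P[/esym/enorm_eq0 ->|v0].
  by rewrite dotC dot0l mulr_ge0 ?enorm_ge0.
have := dot_ge0 (enorm v *: u - enorm u *: v).
rewrite dotDl !dotDr !dotNl !dotNr !dotZl !dotZr (dotC v u) -!enorm_sqr => h.
rewrite -(ler_pM2l (mulr_gt0 u0 v0)); nra.
Qed.

Lemma elipschitz_dot (L : R) (F : 'rV[R]_n -> 'rV[R]_n) u v : elipschitz L F ->
  dot (F u - F v) (u - v) <= L * dot (u - v) (u - v).
Proof.
move=> lipF; apply: le_trans (dot_le_enorm _ _) _.
by rewrite -enorm_sqr expr2 mulrA ler_wpM2r ?enorm_ge0.
Qed.

Lemma derive_grad (g : 'rV[R]_n -> R) u v : differentiable g u ->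
  'D_v g u = dot (grad g u) v.
Proof.
move=> dg; rewrite deriveE // {1}(row_sum_delta v) linear_sum.
apply: eq_bigr => i _.
by rewrite linearZ -deriveE // mxE [RHS]mulrC.
Qed.

(** First-order form of strong convexity: divide the inequality at the point [h *: v + (1 - h) *: u]
    by [h] and let [h] tend to 0 from the right. *)
Lemma strongly_convex_derive (mu : R) (F : 'rV[R]_n -> R) (D : R) u v :
  (forall (x y : 'rV[R]_n) (t : R), 0 <= t <= 1 ->
    F (t *: x + (1 - t) *: y) <=
      t * F x + (1 - t) * F y - mu / 2 * t * (1 - t) * enorm (x - y) ^+ 2) ->
  is_derive u (v - u) F D ->
  F u + D + mu / 2 * dot (v - u) (v - u) <= F v.
Proof.
move=> cvxF [dF <-].
have cvgD : (h^-1 *: (F (h *: (v - u) + u) - F u) @[h --> (0:R)^'+] -->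
    'D_(v - u) F u)%classic.
  exact: cvg_dnbhs_at_right dF.
(* This is the right-hand side of the convexity inequality after subtracting [F u] and dividing by
   [h]. *)
have cvgQ : (F v - F u - mu / 2 * (1 - h) * dot (v - u) (v - u) @[h --> (0:R)^'+]
    --> F v - F u - mu / 2 * (1 - 0) * dot (v - u) (v - u))%classic.
  apply: cvg_at_right_filter; apply: cvgB; first exact: cvg_cst.
  apply: cvgM; last exact: cvg_cst.
  apply: cvgM; first exact: cvg_cst.
  by apply: cvgB; [exact: cvg_cst|exact: cvg_id].
suff : 'D_(v - u) F u <= F v - F u - mu / 2 * (1 - 0) * dot (v - u) (v - u) by lra.
apply: ler_cvg_to cvgD cvgQ _; near=> h.
have h0 : 0 < h by [].
have h1 : h <= 1 by near: h; exact: nbhs_right_le.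
rewrite -(ler_pM2l h0) [_ *: _]/(_ * _) mulVKf ?gt_eqF //.
have -> : h *: (v - u) + u = h *: v + (1 - h) *: u.
  by rewrite scalerBr scalerBl scale1r; apply/rowP => i; rewrite !mxE; ring.
have := cvxF v u h; rewrite enorm_sqr (ltW h0) h1 => /(_ isT); nra.
Unshelve. all: by end_near. Qed.

(** Polyak-Lojasiewicz inequality. The square of [g + mu *: (v - u)] is nonnegative, so the
    quadratic lower model at [u] never falls below [F u - enorm g ^+ 2 / (2 * mu)]. *)
Lemma enorm_grad_ge_gap (mu : R) (F : 'rV[R]_n -> R) (g u v : 'rV[R]_n) :
  0 < mu -> F u + dot g (v - u) + mu / 2 * dot (v - u) (v - u) <= F v ->
  2 * mu * (F u - F v) <= enorm g ^+ 2.
Proof.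
move=> mu0; rewrite enorm_sqr => h; have := dot_ge0 (g + mu *: (v - u)).
rewrite dotDl !dotDr !dotZl !dotZr (dotC (v - u) g); nra.
Qed.

End Euclidean.

(** * Averaged functions and their gradients *)

Section Averages.
Context {R : realType} {n N : nat} {f : 'I_N -> 'rV[R]_n -> R}.

Lemma is_derive_favg (A : {set 'I_N}) (u v : 'rV[R]_n) :
  (forall j, differentiable (f j) u) ->
  is_derive u v (favg f A) (dot (gavg f A u) v).
Proof.
move=> df; have dfA : is_derive u v (\sum_(j in A) f j)
    (\sum_(j in A) dot (grad (f j) u) v).
  elim/big_ind2: _ => [|F a G b dF dG|j _]; first exact: is_derive_cst.
    exact: is_deriveD.
  rewrite -derive_grad //; apply: derivableP; exact: diff_derivable.
have -> : favg f A = #|A|%:R^-1 \*: \sum_(j in A) f j.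
  by apply/funext => y; rewrite /favg /= fct_sumE.
rewrite dotZl dot_suml; exact: is_deriveZ.
Qed.

(** The one-sided form of the Lipschitz condition is linear in the gradient, so it passes to
    averages term by term. *)
Lemma gavg_lipschitz_dot (L : R) (A : {set 'I_N}) (u v : 'rV[R]_n) :
  A != finset.set0 -> (forall j, elipschitz L (grad (f j))) ->
  dot (gavg f A u - gavg f A v) (u - v) <= L * dot (u - v) (u - v).
Proof.
rewrite -card_gt0 => A0 lipf.
have cA0 : 0 < #|A|%:R :> R by rewrite ltr0n.
rewrite /gavg -scalerBr -sumrB dotZl dot_suml -(ler_pM2l cA0) mulVKf ?gt_eqF //.
rewrite mulr_natl -sumr_const; apply: ler_sum => j _.
exact: elipschitz_dot.
Qed.

End Averages.

(** * R-linear sequences and perturbed contractions *)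

(* The strict margin [rho, q < r] absorbs the factor [k] that appears when
   [rho] and [q] coincide. *)
Lemma Rlinear_contraction {R : realType} (rho : R) (a e : nat -> R) :
  0 < rho < 1 -> (forall k, 0 <= a k) -> Rlinear_cvg0 e ->
  (forall k, a k.+1 <= rho * a k + e k) -> Rlinear_cvg0 (fun k => a k.+1).
Proof.
move=> /andP[rho0 rho1] a0 [_ [M [q [M0 /andP[q0 q1] eM]]]] step.
split=> //; pose m := Num.max rho q.
have m1 : m < 1 by rewrite gt_max rho1.
have rhom : rho <= m by rewrite le_max lexx.
have qm : q <= m by rewrite le_max lexx orbT.
(* [K] dominates [a 0] and satisfies [M <= K * (r - rho)], which gives [rho * K * r ^+ k + M * q ^+
   k <= K * r ^+ k.+1]. *)
pose r := (m + 1) / 2; pose K := a 0%N + M / (r - rho).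
have r1 : r < 1 by rewrite /r; lra.
have rhor : 0 < r - rho by rewrite /r; lra.
have r0 : 0 < r by lra.
have K0 : 0 < K by rewrite ltr_wpDl // divr_gt0.
have KM : M <= K * (r - rho).
  by rewrite mulrDl divfK ?gt_eqF // lerDr mulr_ge0 // ltW.
exists (K * r), r; split; [exact: mulr_gt0|by rewrite r0|move=> k].
(* The induction proves [a k <= K * r ^+ k] from index 0; the shift to [a k.+1] accounts for the
   constant [K * r]. *)
rewrite -mulrA -exprS.
elim: k.+1 => [|{}k IH]; first by rewrite expr0 mulr1 lerDl divr_ge0 ?ltW.
have qr : q ^+ k <= r ^+ k by rewrite lerXn2r ?nnegrE ?ltW // /r; lra.
have rk : 0 < r ^+ k by rewrite exprn_gt0.
have := step k; have := eM k; rewrite exprS => h1 h2.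
have h3 : rho * a k <= rho * (K * r ^+ k) by rewrite ler_pM2l.
have h4 : M * q ^+ k <= M * r ^+ k by rewrite ler_pM2l.
have h5 : M * r ^+ k <= K * (r - rho) * r ^+ k by rewrite ler_pM2r.
nra.
Qed.

Lemma Rlinear_cvg0D {R : realType} (a b : nat -> R) :
  Rlinear_cvg0 a -> Rlinear_cvg0 b -> Rlinear_cvg0 (fun k => a k + b k).
Proof.
move=> [a0 [M [q [M0 /andP[q0 q1] aM]]]] [b0 [P [s [P0 /andP[s0 s1] bP]]]].
split=> [k|]; first exact: addr_ge0.
exists (M + P), (Num.max q s); split=> [||k]; first exact: addr_gt0.
  by rewrite lt_max q0 gt_max q1.
rewrite mulrDl; apply: lerD.
  apply: le_trans (aM k) _; rewrite ler_pM2l //.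
  by rewrite lerXn2r ?nnegrE ?le_max ?lexx ?(ltW q0).
apply: le_trans (bP k) _; rewrite ler_pM2l //.
by rewrite lerXn2r ?nnegrE ?le_max ?lexx ?(ltW s0) ?orbT.
Qed.

Lemma Rlinear_cvg0Z {R : realType} (c : R) (a : nat -> R) :
  0 <= c -> Rlinear_cvg0 a -> Rlinear_cvg0 (fun k => c * a k).
Proof.
move=> c0 [a0 [M [q [M0 q01 aM]]]]; split=> [k|]; first exact: mulr_ge0.
(* The factor [c + 1] keeps the constant positive when [c = 0]. *)
exists ((c + 1) * M), q; split=> [|//|k]; first by rewrite mulr_gt0 // ltr_wpDl.
by rewrite -mulrA ler_pM // lerDl.
Qed.

Lemma contraction_sum {R : realType} (rho : R) (a e : nat -> R) :
  0 <= rho -> (forall k, a k.+1 <= rho * a k + e k) ->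
  forall k, a k.+1 <= rho ^+ k.+1 * a 0%N +
    \sum_(0 <= j < k.+1) rho ^+ j * e (k - j)%N.
Proof.
move=> rho0 step; elim=> [|k IH].
  by rewrite big_nat1 expr0 mul1r expr1; exact: step.
apply: le_trans (step _) _; rewrite big_nat_recl // expr0 mul1r subn0.
rewrite addrCA [leLHS]addrC lerD2l.
apply: le_trans (ler_wpM2l rho0 IH) _.
rewrite mulrDr mulrA -exprS lerD2l mulr_sumr.
by under [leRHS]eq_bigr do rewrite subSS exprS -mulrA.
Qed.

(** * Decrease of the sampled function in one line search *)

Section Step.
Context {R : realType} {n N : nat} (f : 'I_N -> 'rV[R]_n -> R).

Lemma spectral_coef_gt0 (sigma_m sigma_M : R) (s y : 'rV[R]_n) :
  0 < sigma_m -> 0 < spectral_coef sigma_m sigma_M s y.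
Proof.
move=> m0; rewrite /spectral_coef; case: ifP => // /and3P[_ ms _].
exact: lt_le_trans ms.
Qed.

Lemma armijo_wolfe_decrease (A : {set 'I_N}) (u d : 'rV[R]_n)
    (c1 c2 L a s z : R) :
  A != finset.set0 -> (forall j, elipschitz L (grad (f j))) ->
  0 < c1 -> 0 < L -> 0 < a -> 0 < s ->
  d = - (s^-1 *: gavg f A u) ->
  favg f A (u + a *: d) <= favg f A u + c1 * a * dot (gavg f A u) d + z ->
  c2 * dot (gavg f A u) d <= dot (gavg f A (u + a *: d)) d ->
  favg f A (u + a *: d) <=
    favg f A u - c1 * (1 - c2) / L * enorm (gavg f A u) ^+ 2 + z.
Proof.
move=> A0 lipf c10 L0 a0 s0 dE decr curv.
have lip := gavg_lipschitz_dot L A (u + a *: d) u A0 lipf.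
rewrite addrAC subrr add0r !dotZr !dotZl mulrCA ler_pM2l // in lip.
rewrite dotDl dotNl in lip.
have dg : dot (gavg f A u) d = - (s^-1 * dot (gavg f A u) (gavg f A u)).
  by rewrite dE dotNr dotZr.
have dd : dot d d = s^-1 * (s^-1 * dot (gavg f A u) (gavg f A u)).
  by rewrite dE dotNl dotNr opprK dotZl dotZr.
rewrite enorm_sqr; move: lip decr curv; rewrite dd !dg.
set G := dot (gavg f A u) (gavg f A u); set t := s^-1 => lip decr curv.
have t0 : 0 < t by rewrite invr_gt0.
(* Curvature and Lipschitz bounds together, with one factor [t] cancelled. The lower bound on
   [a * t] stays multiplied by [G], so a vanishing gradient is covered. *)
have step : (1 - c2) / L * G <= a * (t * G).
  have : t * ((1 - c2) * G) <= t * (L * (a * (t * G))) by lra.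
  by rewrite ler_pM2l // mulrAC ler_pdivrMr // [X in _ -> _ <= X]mulrC.
apply: le_trans decr _; rewrite lerD2r lerD2l.
have : c1 * ((1 - c2) / L * G) <= c1 * (a * (t * G)) by rewrite ler_pM2l.
lra.
Qed.

End Step.

Theorem theorem3p3 (R : realType) (n N : nat) (f : 'I_N -> 'rV[R]_n -> R)
    (rule : subsampling_rule) (form : ydiff_formula)
    (sigma_m sigma_M c1 c2 L : R) (zeta : nat -> R)
    (sample : nat -> {set 'I_N}) (x : nat -> 'rV[R]_n) (sigma alpha : nat -> R)
    (xs : 'rV[R]_n)
    (f_C1 : forall j, continuously_differentiable (f j))
    (sigma_m_bounds : 0 < sigma_m < 1) (sigma_M_gt1 : 1 < sigma_M)
    (c1_gt0 : 0 < c1) (c1_le_c2 : c1 <= c2) (c2_lt1 : c2 < 1)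
    (zeta_gt0 : forall k, 0 < zeta k) (zeta_summable : cvgn (series zeta))
    (run : spectral_run f rule form sigma_m sigma_M c1 c2 zeta sample x sigma alpha)
    (f_strongly_convex : strongly_convex (favg f [set: 'I_N]))
    (xs_min : unique_minimizer (favg f [set: 'I_N]) xs)
    (grad_lipschitz : forall j, elipschitz L (grad (f j))) :
  let fN := favg f [set: 'I_N] in
  let nu := nu_err f sample x in
  let eta := eta_err f sample x in
  let C := - (c1 * (c2 - 1) / L) in
  (exists2 rho : R, 0 < rho < 1 &
     forall k : nat,
       fN (x k.+1) - fN xs <=
         rho ^+ k.+1 * (fN (x 0%N) - fN xs)
         + \sum_(0 <= j < k.+1) rho ^+ j * zeta (k - j)%N
         + \sum_(0 <= j < k.+1) rho ^+ j * (2 * nu (k - j)%N + C * eta (k - j)%N))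
  /\
  (Rlinear_cvg0 zeta -> Rlinear_cvg0 nu -> Rlinear_cvg0 eta ->
     Rlinear_cvg0 (fun k => fN (x k.+1) - fN xs)).
Proof.
move=> fN nu eta C.
have nu0 k : 0 <= nu k by rewrite le_max normr_ge0.
have eta0 k : 0 <= eta k by rewrite le_max normr_ge0.
have gap0 k : 0 <= fN (x k) - fN xs by rewrite subr_ge0; case: xs_min.
have sample_neq0 k : sample k != finset.set0.
  rewrite -card_gt0; elim: k => [|k IH]; first by rewrite card_gt0 (run_sample0 run).
  exact: leq_trans (run_size run k).
have full_neq0 : [set: 'I_N] != finset.set0.
  by have /set0Pn[j _] := sample_neq0 0%N; apply/set0Pn; exists j; rewrite inE.
have sigma_gt0 k : 0 < sigma k.
  have /andP[m0 _] := sigma_m_bounds.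
  case: k => [|k]; last by rewrite (run_sigma run) spectral_coef_gt0.
  by have /andP[+ _] := run_sigma0 run; exact: lt_le_trans.
case: f_strongly_convex => mu mu0 cvx.
have grad_ineq u v := strongly_convex_derive mu fN _ u v cvx
  (is_derive_favg [set: 'I_N] u (v - u) (fun j => (f_C1 j).1 u)).
(* Adding the first-order inequalities at [u] and at [v] shows that the full gradient is strongly
   monotone with constant [mu]. *)
have monotone (u v : 'rV[R]_n) : mu * dot (u - v) (u - v) <= L * dot (u - v) (u - v).
  have := gavg_lipschitz_dot L [set: 'I_N] u v full_neq0 grad_lipschitz.
  have := grad_ineq u v; have := grad_ineq v u.
  rewrite -(opprB u v) !dotNl !dotNr opprK (dotDl (gavg _ _ _)) dotNl; lra.
have [rho rho01 step] : exists2 rho, 0 < rho < 1 & forall k,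
    fN (x k.+1) - fN xs <=
      rho * (fN (x k) - fN xs) + (zeta k + (2 * nu k + C * eta k)).
  (* No sign of [L] is given: it follows from [mu <= L]. Otherwise [monotone] collapses the space to
     one point and any [rho] works. *)
  have [muL|Lmu] := leP mu L; last first.
    have all_eq (u v : 'rV[R]_n) : u = v.
      apply/eqP; rewrite -subr_eq0; apply/eqP/dot_eq0/eqP.
      by rewrite eq_le dot_ge0 andbT; have := monotone u v; nra.
    exists (2^-1); first by lra.
    move=> k; rewrite !(all_eq (x _) xs) subrr mulr0 add0r.
    (* [C] may be negative in this case, so its term has to vanish. *)
    have -> : eta k = 0.
      rewrite /eta /eta_err !(all_eq (gavg _ _ _) 0) subrr normr0.
      by rewrite maxxx.
    by rewrite mulr0 addr0 addr_ge0 ?mulr_ge0 // ltW.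
  have L0 : 0 < L by exact: lt_le_trans muL.
  have CE : C = c1 * (1 - c2) / L by rewrite /C -mulNr -mulrN opprB.
  have C0 : 0 < C by rewrite CE divr_gt0 // mulr_gt0 // subr_gt0.
  have muC : mu * C <= c1 * (1 - c2).
    rewrite CE mulrA ler_pdivrMr // mulrC ler_pM2l //.
    by rewrite mulr_gt0 // subr_gt0.
  (* Here [2 * mu * C <= 2 * c2 * (1 - c2) <= 1 / 2], hence [rho >= 1 / 2]. *)
  exists (1 - 2 * mu * C).
    have := mulr_gt0 mu0 C0.
    have : c1 * (1 - c2) <= c2 * (1 - c2) by rewrite ler_pM2r ?subr_gt0.
    have := sqr_ge0 (2 * c2 - 1); nra.
  move=> k.
  have := armijo_wolfe_decrease f (sample k) (x k) (search_dir f sample x sigma k)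
    c1 c2 L (alpha k) (sigma k) (zeta k) (sample_neq0 k) grad_lipschitz c1_gt0 L0
    (run_alpha run k) (sigma_gt0 k) erefl (run_decrease run k) (run_curvature run k).
  rewrite -(run_step run) -CE => decr.
  have /andP[nu1 nu2] : (`|favg f (sample k) (x k) - fN (x k)| <= nu k) &&
      (`|favg f (sample k) (x k.+1) - fN (x k.+1)| <= nu k) by rewrite -ge_max.
  have eta1 : `|enorm (gavg f [set: 'I_N] (x k)) ^+ 2 -
      enorm (gavg f (sample k) (x k)) ^+ 2| <= eta k by rewrite le_max lexx.
  have pl := enorm_grad_ge_gap mu fN _ _ _ mu0 (grad_ineq (x k) xs).
  (* One [nu k] is paid at [x k] and one at [x k.+1], each from one side of the absolute value. *)
  move: nu1 nu2 eta1; rewrite !ler_norml => /andP[_ nu1] /andP[nu2 _] /andP[_ eta1].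
  have : C * (2 * mu * (fN (x k) - fN xs)) <=
      C * (enorm (gavg f (sample k) (x k)) ^+ 2 + eta k).
    by rewrite ler_pM2l //; lra.
  lra.
have rho_ge0 : 0 <= rho by have /andP[/ltW] := rho01.
split.
  exists rho => // k.
  apply: le_trans (contraction_sum rho (fun k => fN (x k) - fN xs) _ rho_ge0 step k) _.
  rewrite -addrA lerD2l -big_split /=.
  by under eq_bigr do rewrite mulrDr.
move=> zetaR nuR etaR.
(* [C] is replaced by its absolute value because [step] also covers the degenerate case, where [C]
   has no known sign. *)
apply: (Rlinear_contraction rho (fun k => fN (x k) - fN xs)
  (fun k => zeta k + (2 * nu k + `|C| * eta k))) => // [|k].
  apply: Rlinear_cvg0D => //.
  by apply: Rlinear_cvg0D; apply: Rlinear_cvg0Z.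
apply: le_trans (step k) _; rewrite !lerD2l.
by rewrite ler_wpM2r // ler_norm.
Qed.
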